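(* Let $X$ be a Baire space and $n\ge1$ a natural number. If $X$ is Baire $n$-resolvable, then $\mathbf{Baire}(X)$ has a (closure) subalgebra $A$ containing all clopen elements of $\mathbf{Baire}(X)$ such that $\mathsf{S5}_n$ is sound and strongly complete for $A$.
   Context: Meager = countable union of nowhere dense sets; Baire space: no nonempty open set is meager; $X$ is Baire $n$-resolvable if it has a partition into $n$ sets each meeting every nonempty open set in a non-meager set. $\mathbf{Baire}(X)$ is the closure algebra $\wp(X)$ modulo meager sets with $\mathbf c a$ the least class $[F]$, $F$ closed, above $a$; an element is clopen if it equals $\mathbf c$ of itself and its complement does too (equivalently it is $[U]$ with $U$ open). $\mathsf{S5}_n$ is $\mathsf{S5}$ (tautologies, $\Diamond(p\vee q)\to\Diamond p\vee\Diamond q$, $p\to\Diamond p$, $\Diamond\Diamond p\to\Diamond p$, $\neg\Diamond\bot$, $\Diamond p\to\Box\Diamond p$, substitution, modus ponens, monotonicity) plus $\bigwedge_{i=1}^{n+1}\Diamond p_i\to\bigvee_{1\le i<j\le n+1}\Diamond(p_i\wedge p_j)$. For a closure algebra $B$: valuations interpret $\Diamond$ as closure; $B\models\varphi$ if all valuations give $1$; $\Gamma\models_B\varphi$ means $B\models\Gamma$ implies $B\models\varphi$; sound means all theorems valid; strongly complete means $\Gamma\models_B\varphi$ implies $\varphi$ derivable from $\Gamma$ as extra axioms.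
   Formalization: Γ ⊨_A φ is taken valuation by valuation (each valuation giving every member of Γ the value 1 gives φ the value 1), since the all-valuations reading makes strong completeness false for n ≥ 2; extra axioms are not closed under substitution, and the partition's blocks are nonempty. *)

(* Defs.v *)
From HB Require Import structures.
From mathcomp Require Import all_boot all_order.
From mathcomp Require Import generic_quotient.
From mathcomp Require Import all_classical topology_structure.

Set Implicit Arguments.
Unset Strict Implicit.
Unset Printing Implicit Defensive.

Import Order.Theory.

Local Open Scope classical_set_scope.
Local Open Scope quotient_scope.

HB.mixin Record hasClosureOp d B of Order.CTBDistrLattice d B := {
  clo : B -> B;
  clo0 : clo \bot%O = \bot%O;
  cloU : forall a b : B, clo (a `|` b)%O = (clo a `|` clo b)%O;
  le_clo : forall a : B, (a <= clo a)%O;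
  clo_clo : forall a : B, clo (clo a) = clo a;
}.

#[short(type="closureAlgType")]
HB.structure Definition ClosureAlgebra d :=
  { B of Order.CTBDistrLattice d B & hasClosureOp d B }.

Definition clopen_elt d (B : closureAlgType d) (a : B) : Prop :=
  a = clo a /\ (~` a)%O = clo (~` a)%O.

Record subalgebra d (B : closureAlgType d) := Subalgebra {
  subalg_pred :> {pred B};
  subalg0 : \bot%O \in subalg_pred;
  subalg1 : \top%O \in subalg_pred;
  subalgI : {in subalg_pred &, forall a b, (a `&` b)%O \in subalg_pred};
  subalgU : {in subalg_pred &, forall a b, (a `|` b)%O \in subalg_pred};
  subalgC : {in subalg_pred, forall a, (~` a)%O \in subalg_pred};
  subalg_clo : {in subalg_pred, forall a, clo a \in subalg_pred};
}.

Section SubalgebraType.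
Context d (B : closureAlgType d) (A : subalgebra B).

Record subalg_type := SubalgElt {
  subalg_val : B;
  _ : subalg_val \in subalg_pred A;
}.

HB.instance Definition _ := [isSub for subalg_val].
HB.instance Definition _ := [Choice of subalg_type by <:].
HB.instance Definition _ := Order.SubChoice_isTBSubLattice.Build
  d B (mem (subalg_pred A)) d subalg_type
  (@subalgI _ _ A) (@subalgU _ _ A) (subalg0 A) (subalg1 A).

Implicit Types a b c : subalg_type.

Fact subalg_meetUl : @left_distributive subalg_type subalg_type
  Order.meet Order.join.
Proof. by move=> a b c; apply: val_inj; rewrite /= meetUl. Qed.

HB.instance Definition _ :=
  Order.Lattice_Meet_isDistrLattice.Build d subalg_type subalg_meetUl.

Definition subalg_compl a : subalg_type := SubalgElt (subalgC (valP a)).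

Fact subalg_joinxC a : (a `|` subalg_compl a = \top)%O.
Proof. by apply: val_inj; rewrite /= joinxC. Qed.

Fact subalg_meetxC a : (a `&` subalg_compl a = \bot)%O.
Proof. by apply: val_inj; rewrite /= meetxC. Qed.

HB.instance Definition _ :=
  Order.TBDistrLattice_hasComplement.Build d subalg_type
    subalg_joinxC subalg_meetxC.

Definition subalg_clo_op a : subalg_type := SubalgElt (subalg_clo (valP a)).

Fact subalg_clo0 : subalg_clo_op \bot%O = \bot%O.
Proof. by apply: val_inj; rewrite /= clo0. Qed.

Fact subalg_cloU a b :
  subalg_clo_op (a `|` b)%O = (subalg_clo_op a `|` subalg_clo_op b)%O.
Proof. by apply: val_inj; rewrite /= cloU. Qed.

Fact subalg_le_clo a : (a <= subalg_clo_op a)%O.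
Proof. exact: le_clo. Qed.

Fact subalg_clo_clo a : subalg_clo_op (subalg_clo_op a) = subalg_clo_op a.
Proof. by apply: val_inj; rewrite /= clo_clo. Qed.

HB.instance Definition _ := hasClosureOp.Build d subalg_type
  subalg_clo0 subalg_cloU subalg_le_clo subalg_clo_clo.

End SubalgebraType.

Section Meager.
Context {X : topologicalType}.
Implicit Types A B : set X.

Definition nowhere_dense A := interior (closure A) = set0.

Definition meager A := exists F : nat -> set X,
  (forall i, nowhere_dense (F i)) /\ A = \bigcup_i F i.

Lemma nowhere_denseP A : nowhere_dense A <->
  forall U, open U -> U !=set0 -> exists V, [/\ open V, V !=set0, V `<=` U &
    V `&` A = set0].
Proof.
split=> [ndA U oU [x Ux]|ndA].
  have [UA|] := pselect (U `<=` closure A).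
    have : (closure A)° x by apply: (interiorS UA); rewrite (interior_id U).1.
    by rewrite ndA.
  move=> /existsNP[y /not_implyP[Uy nAy]]; exists (U `&` ~` closure A); split.
  - by apply: openI => //; apply/closed_openC/closed_closure.
  - by exists y.
  - exact: subIsetl.
  - by apply/seteqP; split => // z [[_ nz] Az]; apply/nz/subset_closure.
apply/seteqP; split => // x Ix.
have [|V [oV [y Vy] VI VA]] := ndA _ (open_interior (closure A)); first by exists x.
have /interior_subset clAy := VI _ Vy.
have [z [Az Vz]] := clAy V (open_nbhs_nbhs (conj oV Vy)).
by have : (V `&` A) z by []; rewrite VA.
Qed.

Lemma nowhere_dense_sub A B : A `<=` B -> nowhere_dense B -> nowhere_dense A.
Proof.
move=> AB ndB; rewrite /nowhere_dense -subset0 -ndB.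
exact/interiorS/closureS.
Qed.

Lemma nowhere_dense0 : nowhere_dense set0.
Proof. by rewrite /nowhere_dense closure0 interior0. Qed.

Lemma meager_nowhere_dense A : nowhere_dense A -> meager A.
Proof.
by move=> ndA; exists (fun=> A); split => //; rewrite bigcup_const//; exists 0.
Qed.

Lemma meager_sub A B : A `<=` B -> meager B -> meager A.
Proof.
move=> AB [F [ndF BE]]; exists (fun i => A `&` F i); split.
  by move=> i; apply: nowhere_dense_sub (ndF i); exact: subIsetr.
by rewrite -setI_bigcupr -BE; apply/esym/setIidPl.
Qed.

Lemma meager0 : meager set0.
Proof. exact/meager_nowhere_dense/nowhere_dense0. Qed.

Lemma meager_bigcup (F : nat -> set X) :
  (forall i, meager (F i)) -> meager (\bigcup_i F i).
Proof.
move=> /choice[G GF].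
exists (fun k => if unpickle k is Some (i, j) then G i j else set0); split.
  move=> k; case: unpickle => [[i j]|]; last exact: nowhere_dense0.
  exact: (GF i).1.
apply/seteqP; split => [x [i _]|x [k _]].
  rewrite (GF i).2 => -[j _ Gx]; exists (pickle (i, j)) => //.
  by rewrite pickleK.
case: unpickle => [[i j] Gx|//]; exists i => //.
by rewrite (GF i).2; exists j.
Qed.

Lemma meagerU A B : meager A -> meager B -> meager (A `|` B).
Proof.
move=> mA mB; apply: (@meager_sub _ (\bigcup_i (if i is 0 then A else B))).
  by move=> x [Ax|Bx]; [exists 0|exists 1].
by apply: meager_bigcup => -[|i].
Qed.

(* Banach category theorem *)
Lemma meager_locally A :
  meager (A `&` \bigcup_(U in [set U | open U /\ meager (A `&` U)]) U).
Proof.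
set D := [set U | _].
have [E [ED tE maxE]] := ex_maximal_disjoint_subcollection id D.
pose W := \bigcup_(U in E) U.
have oW : open W by apply: bigcup_open => U /ED[].
have DW : \bigcup_(U in D) U `<=` closure W.
  move=> x [U [oU mU] Ux]; apply: contrapT => nWx.
  pose V := U `&` ~` closure W.
  have oV : open V.
    by apply: openI => //; apply/closed_openC/closed_closure.
  have Vx : V x by [].
  have nEV : ~ E V.
    by move=> EV; apply: nWx; apply: subset_closure; exists V.
  apply: (maxE (E `|` [set V])).
  - split; first exact: subsetUl.
    by move=> /(_ V (or_intror erefl)).
  - move=> _ [/ED//|->]; split => //.
    by apply: meager_sub mU => y [? []].
  - have disj U' : E U' -> U' `&` V = set0.
      move=> EU'; apply/seteqP; split => // y [U'y [_]]; apply.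
      by apply: subset_closure; exists U'.
    move=> P Q [EP|->] [EQ|->] //= [y [Py Qy]].
    + by apply: tE => //; exists y.
    + by have : (P `&` V) y by []; rewrite disj.
    + by have : (Q `&` V) y by []; rewrite disj.
apply: (@meager_sub _ ((A `&` W) `|` (closure W `\` W))).
  move=> x [Ax /DW cWx]; have [Wx|nWx] := pselect (W x); first by left.
  by right.
apply: meagerU; last first.
  apply: meager_nowhere_dense; apply/nowhere_denseP => U oU [x Ux].
  have [[y [Uy Wy]]|/nonemptyPn UW] := pselect (U `&` W !=set0).
    exists (U `&` W); split => //; first exact: openI.
    - by exists y.
    - by apply/seteqP; split => // z [[_ ?] []].
  exists U; split => //; first by exists x.
  apply/seteqP; split => // z [Uz [cWz _]].
  have [t [Wt Ut]] := cWz U (open_nbhs_nbhs (conj oU Uz)).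
  by have : (U `&` W) t by []; rewrite UW.
have /choice[N NE] : forall U : set X, exists F : nat -> set X, E U ->
    (forall i, nowhere_dense (F i)) /\ A `&` U = \bigcup_i F i.
  move=> U; have [/ED[_ [F FE]]|nEU] := pselect (E U); first by exists F.
  by exists (fun=> set0).
have NU U i : E U -> N U i `<=` U.
  move=> EU x Nx; have : (A `&` U) x by rewrite (NE U EU).2; exists i.
  by case.
exists (fun i => \bigcup_(U in E) N U i); split; last first.
  apply/seteqP; split => [x [Ax [U EU Ux]]|x [i _ [U EU Nx]]].
    have : (A `&` U) x by [].
    by rewrite (NE U EU).2 => -[i _ Nx]; exists i => //; exists U.
  have : (A `&` U) x by rewrite (NE U EU).2; exists i.
  by move=> [Ax Ux]; split => //; exists U.
move=> i; apply/nowhere_denseP => O oO O0.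
have [[x [Ox [U EU Ux]]]|/nonemptyPn OW] := pselect (O `&` W !=set0); last first.
  exists O; split => //; apply/seteqP; split => // z [Oz [U EU /NU]].
  move=> /(_ EU) Uz; have : (O `&` W) z by split => //; exists U.
  by rewrite OW.
have /nowhere_denseP := (NE U EU).1 i.
case/(_ (O `&` U)); [|by exists x|].
  by apply: openI => //; exact: (ED _ EU).1.
move=> V [oV V0 VOU VN]; exists V; split => //.
  by move=> z /VOU[].
apply/seteqP; split => // z [Vz [U' EU' N'z]].
have UU' : U' = U.
  apply: tE => //; exists z; split; first exact: NU N'z.
  exact: (VOU _ Vz).2.
by have : set0 z by rewrite -VN -UU'.
Qed.

End Meager.

Definition Baire_space (X : topologicalType) : Prop :=
  forall U : set X, open U -> U !=set0 -> ~ meager U.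

Definition Baire_resolvable (X : topologicalType) (n : nat) : Prop :=
  exists P : 'I_n -> set X,
    [/\ forall i, P i !=set0, trivIset setT P, \bigcup_i P i = setT &
        forall i (U : set X), open U -> U !=set0 -> ~ meager (P i `&` U)].

Section BaireAlgebra.
Context {X : topologicalType}.
Implicit Types A B C : set X.

Definition eq_meager : rel (set X) := fun A B => `[< meager (A `+` B) >].

Fact eq_meager_refl : reflexive eq_meager.
Proof. by move=> A; apply/asboolP; rewrite setYK; exact: meager0. Qed.

Fact eq_meager_sym : symmetric eq_meager.
Proof. by move=> A B; rewrite /eq_meager setYC. Qed.

Fact eq_meager_trans : transitive eq_meager.
Proof.
move=> B A C /asboolP mAB /asboolP mBC; apply/asboolP.
apply: meager_sub (meagerU mAB mBC) => x; rewrite !setY_def /=.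
by have [|] := pselect (B x); tauto.
Qed.

Canonical eq_meager_equiv :=
  EquivRel eq_meager eq_meager_refl eq_meager_sym eq_meager_trans.

End BaireAlgebra.

Definition Baire (X : topologicalType) := {eq_quot (@eq_meager X)}.

Fact Baire_display : Order.disp_t. Proof. exact: Order.Disp tt tt. Qed.

Section BaireLattice.
Context {X : topologicalType}.
Implicit Types (A B C : set X) (a b c : Baire X).

HB.instance Definition _ := Choice.on (Baire X).
HB.instance Definition _ := EqQuotient.on (Baire X).

Definition Bclass A : Baire X := \pi A.

Lemma BclassP a : exists A, a = Bclass A.
Proof. by exists (repr a); rewrite /Bclass reprK. Qed.

Lemma eq_BclassP A B : Bclass A = Bclass B <-> meager (A `+` B).
Proof. by split => [/eqmodP/asboolP//|mAB]; apply/eqmodP/asboolP. Qed.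

Definition Bmeet a b : Baire X := Bclass (repr a `&` repr b).
Definition Bjoin a b : Baire X := Bclass (repr a `|` repr b).
Definition Bcompl a : Baire X := Bclass (~` repr a).

Lemma repr_Bclass A : meager (repr (Bclass A) `+` A).
Proof. by apply/eq_BclassP; rewrite /Bclass reprK. Qed.

Lemma BmeetE A B : Bmeet (Bclass A) (Bclass B) = Bclass (A `&` B).
Proof.
apply/eq_BclassP.
apply: meager_sub (meagerU (repr_Bclass A) (repr_Bclass B)) => x.
rewrite !setY_def /=; have [|] := pselect (A x); have [|] := pselect (B x);
by have [|] := pselect (repr (Bclass A) x); tauto.
Qed.

Lemma BjoinE A B : Bjoin (Bclass A) (Bclass B) = Bclass (A `|` B).
Proof.
apply/eq_BclassP.
apply: meager_sub (meagerU (repr_Bclass A) (repr_Bclass B)) => x.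
rewrite !setY_def /=; have [|] := pselect (A x); have [|] := pselect (B x);
by have [|] := pselect (repr (Bclass A) x); tauto.
Qed.

Lemma BcomplE A : Bcompl (Bclass A) = Bclass (~` A).
Proof.
apply/eq_BclassP; apply: meager_sub (repr_Bclass A) => x.
rewrite !setY_def /=; have [|] := pselect (A x);
by have [|] := pselect (repr (Bclass A) x); tauto.
Qed.

Definition Ble a b := Bmeet a b == a.
Definition Blt a b := (b != a) && Ble a b.

Fact BmeetC : commutative Bmeet.
Proof. by move=> a b; rewrite /Bmeet setIC. Qed.

Fact BjoinC : commutative Bjoin.
Proof. by move=> a b; rewrite /Bjoin setUC. Qed.

Fact BmeetA : associative Bmeet.
Proof.
move=> a b c; have [[A ->] [B ->] [C ->]] := And3 (BclassP a) (BclassP b) (BclassP c).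
by rewrite !BmeetE setIA.
Qed.

Fact BjoinA : associative Bjoin.
Proof.
move=> a b c; have [[A ->] [B ->] [C ->]] := And3 (BclassP a) (BclassP b) (BclassP c).
by rewrite !BjoinE setUA.
Qed.

Fact BjoinKI b a : Bmeet a (Bjoin a b) = a.
Proof.
have [[A ->] [B ->]] := conj (BclassP a) (BclassP b).
by rewrite BjoinE BmeetE setUC setKU.
Qed.

Fact BmeetKU b a : Bjoin a (Bmeet a b) = a.
Proof.
have [[A ->] [B ->]] := conj (BclassP a) (BclassP b).
by rewrite BmeetE BjoinE setIC setKI.
Qed.

Fact BmeetUl : left_distributive Bmeet Bjoin.
Proof.
move=> a b c; have [[A ->] [B ->] [C ->]] := And3 (BclassP a) (BclassP b) (BclassP c).
by rewrite BjoinE !BmeetE BjoinE setIUl.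
Qed.

Fact Bmeetxx : idempotent_op Bmeet.
Proof. by move=> a; have [A ->] := BclassP a; rewrite BmeetE setIid. Qed.

HB.instance Definition _ :=
  Order.isMeetJoinDistrLattice.Build Baire_display (Baire X)
    (fun _ _ => erefl) (fun _ _ => erefl) BmeetC BjoinC BmeetA BjoinA
    BjoinKI BmeetKU BmeetUl Bmeetxx.

Lemma Bclass_le A B : (Bclass A <= Bclass B)%O <-> meager (A `\` B).
Proof.
have -> : A `\` B = (A `&` B) `+` A.
  apply/seteqP; split => x; rewrite setY_def /=; last tauto.
  by move=> [? ?]; right; split => // -[].
rewrite -eq_BclassP -BmeetE.
by rewrite -[(_ <= _)%O]/(Bmeet (Bclass A) (Bclass B) == Bclass A); split => /eqP.
Qed.

Fact Ble0x a : (Bclass set0 <= a)%O.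
Proof. by have [A ->] := BclassP a; apply/Bclass_le; rewrite set0D; exact: meager0. Qed.

Fact Blex1 a : (a <= Bclass setT)%O.
Proof. by have [A ->] := BclassP a; apply/Bclass_le; rewrite setDT; exact: meager0. Qed.

HB.instance Definition _ := Order.hasBottom.Build Baire_display (Baire X) Ble0x.
HB.instance Definition _ := Order.hasTop.Build Baire_display (Baire X) Blex1.

Fact BjoinxC a : (a `|` Bcompl a = \top)%O.
Proof.
by have [A ->] := BclassP a; rewrite BcomplE [LHS]BjoinE setUv.
Qed.

Fact BmeetxC a : (a `&` Bcompl a = \bot)%O.
Proof.
by have [A ->] := BclassP a; rewrite BcomplE [LHS]BmeetE setICr.
Qed.

HB.instance Definition _ :=
  Order.TBDistrLattice_hasComplement.Build Baire_display (Baire X)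
    BjoinxC BmeetxC.

Definition least_closed_above a c : Prop :=
  [/\ exists2 F : set X, closed F & c = Bclass F,
      (a <= c)%O &
      forall F : set X, closed F -> (a <= Bclass F)%O -> (c <= Bclass F)%O].

(* The default value \top is never used: see Bclo_least. *)
Definition Bclo a : Baire X := xget \top%O [set c | least_closed_above a c].

Lemma Bclo_least a : least_closed_above a (Bclo a).
Proof.
suff [c ac] : exists c, least_closed_above a c.
  exact: (@xgetPex _ \top%O [set c | least_closed_above a c] (ex_intro _ c ac)).
have [A ->] := BclassP a.
pose U := \bigcup_(U in [set U | open U /\ meager (A `&` U)]) U.
exists (Bclass (~` U)); split.
- exists (~` U) => //; apply: open_closedC; apply: bigcup_open.
  by move=> V [].
- by apply/Bclass_le; rewrite setDE setCK; exact: meager_locally.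
- move=> F cF /Bclass_le mAF; apply/Bclass_le.
  apply: meager_sub meager0 => x [nUx nFx]; apply: nUx.
  exists (~` F) => //; split; first exact: closed_openC.
  by rewrite -setDE.
Qed.

Lemma Bclo_homo a b : (a <= b)%O -> (Bclo a <= Bclo b)%O.
Proof.
move=> ab; have [_ _ +] := Bclo_least a; have [[F cF ->] bF _] := Bclo_least b.
by apply => //; exact: le_trans ab bF.
Qed.

Fact le_Bclo a : (a <= Bclo a)%O.
Proof. by have [] := Bclo_least a. Qed.

Fact Bclo0 : Bclo \bot%O = \bot%O.
Proof.
apply/eqP; rewrite -lex0; have [_ _] := Bclo_least \bot%O.
by move=> /(_ _ closed0 (lexx _)).
Qed.

Fact Bclo_clo a : Bclo (Bclo a) = Bclo a.
Proof.
apply/le_anti; rewrite le_Bclo andbT.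
have [[F cF E] _ _] := Bclo_least a.
by have [_ _] := Bclo_least (Bclo a); rewrite E => /(_ _ cF (lexx _)).
Qed.

Fact BcloU a b : Bclo (a `|` b)%O = (Bclo a `|` Bclo b)%O.
Proof.
apply/le_anti/andP; split; last first.
  by rewrite leUx !Bclo_homo ?leUl ?leUr.
have [[F cF EF] aF _] := Bclo_least a; have [[G cG EG] bG _] := Bclo_least b.
have -> : (Bclo a `|` Bclo b)%O = Bclass (F `|` G).
  by rewrite EF EG [LHS]BjoinE.
have [_ _] := Bclo_least (a `|` b)%O; apply; first exact: closedU.
by rewrite -[X in (_ <= X)%O]BjoinE -EF -EG leU2.
Qed.

HB.instance Definition _ := hasClosureOp.Build Baire_display (Baire X)
  Bclo0 BcloU le_Bclo Bclo_clo.

End BaireLattice.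

Inductive form : Type :=
| Var of nat
| Bot
| Neg of form
| And of form & form
| Or of form & form
| Dia of form.

Definition Top := Neg Bot.
Definition Imp f g := Or (Neg f) g.
Definition Box f := Neg (Dia (Neg f)).

Fixpoint subst (s : nat -> form) (f : form) : form :=
  match f with
  | Var p => s p
  | Bot => Bot
  | Neg f => Neg (subst s f)
  | And f g => And (subst s f) (subst s g)
  | Or f g => Or (subst s f) (subst s g)
  | Dia f => Dia (subst s f)
  end.

(* Truth-table value, the variables and the formulas [Dia f] being atoms. *)
Fixpoint bool_val (v : form -> bool) (f : form) : bool :=
  match f with
  | Var _ | Dia _ => v f
  | Bot => false
  | Neg f => ~~ bool_val v f
  | And f g => bool_val v f && bool_val v g
  | Or f g => bool_val v f || bool_val v g
  end.

Definition tautology (f : form) : Prop := forall v, bool_val v f.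

Inductive S5_axiom : form -> Prop :=
| Ax_taut f : tautology f -> S5_axiom f
| Ax_DiaOr :
    S5_axiom (Imp (Dia (Or (Var 0) (Var 1))) (Or (Dia (Var 0)) (Dia (Var 1))))
| Ax_T : S5_axiom (Imp (Var 0) (Dia (Var 0)))
| Ax_4 : S5_axiom (Imp (Dia (Dia (Var 0))) (Dia (Var 0)))
| Ax_N : S5_axiom (Neg (Dia Bot))
| Ax_5 : S5_axiom (Imp (Dia (Var 0)) (Box (Dia (Var 0)))).

Definition alt_axiom (n : nat) : form :=
  Imp (\big[And/Top]_(i < n.+1) Dia (Var i))
      (\big[Or/Bot]_(i < n.+1) \big[Or/Bot]_(j < n.+1 | i < j)
         Dia (And (Var i) (Var j))).

Inductive S5n (n : nat) : set form :=
| S5n_axiom f : S5_axiom f -> S5n n f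
| S5n_alt : S5n n (alt_axiom n)
| S5n_subst s f : S5n n f -> S5n n (subst s f)
| S5n_mp f g : S5n n (Imp f g) -> S5n n f -> S5n n g
| S5n_mono f g : S5n n (Imp f g) -> S5n n (Imp (Dia f) (Dia g)).

(* Derivability in the logic L from the extra axioms G. The substitution rule *)
(* is part of L but is not applied to the members of G.                       *)
Inductive derivable (L G : set form) : set form :=
| der_thm f : L f -> derivable L G f
| der_hyp f : G f -> derivable L G f
| der_mp f g : derivable L G (Imp f g) -> derivable L G f -> derivable L G g
| der_mono f g : derivable L G (Imp f g) ->
    derivable L G (Imp (Dia f) (Dia g)).

Section Semantics.
Context d (B : closureAlgType d).

Fixpoint eval (v : nat -> B) (f : form) : B :=
  match f with
  | Var p => v p
  | Bot => \bot%O
  | Neg f => (~` eval v f)%O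
  | And f g => (eval v f `&` eval v g)%O
  | Or f g => (eval v f `|` eval v g)%O
  | Dia f => clo (eval v f)
  end.

Definition valid (f : form) : Prop := forall v : nat -> B, eval v f = \top%O.

(* Premises and conclusion are evaluated under the same valuation. With       *)
(* [(forall g, G g -> valid g) -> valid f] instead, no B would make S5n n     *)
(* strongly complete for 2 <= n: let h be [Imp (Dia (Var 0)) (Var 0)]. If h   *)
(* is valid in B, then h follows from no premise but is not a theorem; else   *)
(* Bot vacuously follows from h but is not derivable from it.                 *)
Definition entails (G : set form) (f : form) : Prop :=
  forall v : nat -> B,
    (forall g, G g -> eval v g = \top%O) -> eval v f = \top%O.

End Semantics.

Definition sound (L : set form) d (B : closureAlgType d) : Prop :=
  forall f, L f -> valid B f.

Definition strongly_complete (L : set form) d (B : closureAlgType d) : Prop :=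
  forall (G : set form) (f : form), entails B G f -> derivable L G f.

(* Main.v *)
(** Modulo meager sets every closed set equals its interior, so the closure of
    an element of [Baire X] is the class of an open set and is clopen: [Baire X]
    validates S5. Given a resolution [P], the classes of the sets
    [\bigcup_i (P i `&` U i)] with every [U i] open form a closure subalgebra
    containing the clopen elements, and the closure of such a class is
    [\bigcup_i U i] because every [P i] is non-meager in every nonempty open
    set. Among [n + 1] such classes whose closures share a point [x], two have
    [x] in the same component [U i], whence the alternativity axiom.
    Conversely, a formula not derivable from [G] is refuted in a cluster of at
    most [n] maximal theories; sending the pieces [P i] onto its points embeds
    its power set algebra in the subalgebra. *)

Require Import Defs.
From HB Require Import structures.
From mathcomp Require Import all_boot all_order.
From mathcomp Require Import all_classical topology_structure.

Set Implicit Arguments.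
Unset Strict Implicit.
Unset Printing Implicit Defensive.

Import Order.Theory.

Local Open Scope classical_set_scope.

(** * Formulas and truth tables *)

Section BoolVal.
Context (v : form -> bool).

Lemma bool_val_bigAnd (I : finType) (P : pred I) (F : I -> form) :
  bool_val v (\big[And/Top]_(i | P i) F i) = [forall (i | P i), bool_val v (F i)].
Proof. by rewrite (big_morph _ (id1 := true) (op1 := andb))// big_andE. Qed.

Lemma bool_val_bigOr (I : finType) (P : pred I) (F : I -> form) :
  bool_val v (\big[Or/Bot]_(i | P i) F i) = [exists (i | P i), bool_val v (F i)].
Proof. by rewrite (big_morph _ (id1 := false) (op1 := orb))// big_orE. Qed.

Lemma bool_val_alt n (s : nat -> form) :
  bool_val v (subst s (alt_axiom n)) ->
  (forall i : 'I_n.+1, v (Dia (s i))) ->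
  exists i j : 'I_n.+1, i < j /\ v (Dia (And (s i) (s j))).
Proof.
rewrite /alt_axiom /=.
rewrite (big_morph (subst s) (id1 := Top) (op1 := And) (id2 := Top) (op2 := And))//.
rewrite (big_morph (subst s) (id1 := Bot) (op1 := Or) (id2 := Bot) (op2 := Or))//.
rewrite bool_val_bigAnd bool_val_bigOr => /orP[/forallP vN vs|/existsP[i /=]].
  by exfalso; apply: vN => i; exact: vs.
rewrite (big_morph (subst s) (id1 := Bot) (op1 := Or))// bool_val_bigOr.
by move=> /existsP[j /andP[ij vij]] _; exists i, j.
Qed.

Lemma bool_valT_alt n :
  ((forall i : 'I_n.+1, v (Dia (Var i))) ->
   exists i j : 'I_n.+1, i < j /\ v (Dia (And (Var i) (Var j)))) ->
  bool_val v (alt_axiom n).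
Proof.
move=> vij; rewrite /alt_axiom /= bool_val_bigAnd bool_val_bigOr -implybE.
apply/implyP => /forallP/= /vij[i [j [ij vd]]].
by apply/existsP; exists i; rewrite bool_val_bigOr; apply/existsP; exists j; rewrite ij.
Qed.

End BoolVal.

(** * Maximal theories *)

Definition theory (T : set form) : Prop :=
  tautology `<=` T /\ forall f g, T (Imp f g) -> T f -> T g.

Definition max_theory (u : set form) : Prop :=
  theory u /\ forall f, u (Neg f) <-> ~ u f.

Ltac taut := let v := fresh "v" in move=> v //=;
  repeat match goal with |- context [bool_val v ?f] =>
    case: (bool_val v f) => //= end; repeat match goal with |- context [v ?f] =>
    case: (v f) => //= end.

Lemma theory1 T f g : theory T -> tautology (Imp f g) -> T f -> T g.
Proof. by move=> [tT mp] fg; apply: mp; exact: tT. Qed.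

Lemma theory2 T f g h : theory T -> tautology (Imp f (Imp g h)) ->
  T f -> T g -> T h.
Proof. by move=> thT fgh /(theory1 thT fgh); exact: thT.2. Qed.

Lemma theory_bigcup (F : set (set form)) :
  F !=set0 -> F `<=` theory -> total_on F subset ->
  theory (\bigcup_(T in F) T).
Proof.
move=> [T0 FT0] thF totF; split; first by move=> f tf; exists T0 => //; exact: (thF _ FT0).1.
move=> f g [T FT Tfg] [T' FT' Tf]; have [TT'|T'T] := totF _ _ FT FT'.
  by exists T' => //; apply: (thF _ FT').2 Tf; exact: TT'.
by exists T => //; apply: (thF _ FT).2 Tfg _; exact: T'T.
Qed.

Lemma theory_adjoin T f : theory T -> theory [set g | T (Imp f g)].
Proof.
move=> thT; split => [g tg /=|g h /= Tgh Tg].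
  by apply: thT.1 => v; rewrite /= tg orbT.
by apply: theory2 Tgh Tg => //; taut.
Qed.

Lemma Lindenbaum T f : theory T -> ~ T f ->
  exists u, [/\ max_theory u, T `<=` u & ~ u f].
Proof.
move=> thT nTf.
(* [Zorn_bigcup] also demands the union of the empty chain. *)
pose P u := u = set0 \/ [/\ theory u, T `<=` u & ~ u f].
have [F FP totF|u [Pu maxu]] := @Zorn_bigcup _ P.
  have [[u0 Fu0 u00]|F0] := pselect (exists2 u, F u & u != set0); last first.
    left; apply/seteqP; split => // g [u Fu ug]; apply: F0; exists u => //.
    by apply/set0P; exists g.
  right; pose F' := [set u | F u /\ u != set0].
  have -> : \bigcup_(u in F) u = \bigcup_(u in F') u.
    apply/seteqP; split => g [u Fu ug]; exists u => //; last exact: Fu.1.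
    by split => //; apply/set0P; exists g.
  have F'P u : F' u -> [/\ theory u, T `<=` u & ~ u f].
    by move=> [/FP[->|//]]; rewrite eqxx.
  split.
  - apply: theory_bigcup => [|u /F'P[]//|u w [Fu _] [Fw _]]; last exact: totF.
    by exists u0.
  - by move=> g Tg; exists u0 => //; have [//|_ Tu _] := F'P u0; exact: Tu.
  - by move=> [u /F'P[_ _]].
case: Pu => [u0|[thu Tu nuf]].
  have PT : P T by right; split.
  exfalso; apply: maxu PT; rewrite u0; split=> // /(_ Top); apply; apply: thT.1; taut.
have adj g : ~ u g -> u (Imp g f).
  move=> nug; apply: contrapT => nugf.
  have : P [set h | u (Imp g h)]; last apply: maxu.
    right; split => //; first exact: theory_adjoin.
    by move=> h /Tu; apply: theory1 => //; taut.
  split; first by move=> h; apply: theory1 => //; taut.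
  by move=> /(_ g); apply: contra_not nug; apply; apply: thu.1; taut.
exists u; split=> //; split=> // g; split=> [ung ug|nug].
  by apply/nuf; apply: theory2 ung ug => //; taut.
apply: contrapT => /adj ungf; apply: nuf.
by apply: theory2 (adj _ nug) ungf => //; taut.
Qed.

Section MaxTheory.
Context (u : set form) (mu : max_theory u).

Lemma max_theoryE f : bool_val (fun g => `[< u g >]) f = `[< u f >].
Proof.
have [thu uN] := mu.
elim: f => //= [|f ->|f -> g ->|f -> g ->].
- apply/esym/asboolPn/(uN Bot).1; apply: thu.1; taut.
- by rewrite -asbool_neg; apply/asbool_equiv_eq; split => /uN.
- rewrite -asbool_and; apply/asbool_equiv_eq; split => [[]|].
    by apply: theory2 => //; taut.
  by move=> ufg; split; apply: theory1 ufg => //; taut.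
- rewrite -asbool_or; apply/asbool_equiv_eq; split => [[]|].
  + by apply: theory1 => //; taut.
  + by apply: theory1 => //; taut.
  + move=> ufg; apply: contrapT => /not_orP[/uN nf ng].
    by apply: ng; apply: theory2 ufg nf => //; taut.
Qed.

Lemma max_theory_And f g : u (And f g) <-> u f /\ u g.
Proof.
have := max_theoryE (And f g); rewrite /= !max_theoryE -asbool_and => e.
by split => /asboolP; [rewrite -e|rewrite e] => /asboolP.
Qed.

Lemma max_theory_Or f g : u (Or f g) <-> u f \/ u g.
Proof.
have := max_theoryE (Or f g); rewrite /= !max_theoryE -asbool_or => e.
by split => /asboolP; [rewrite -e|rewrite e] => /asboolP.
Qed.

Lemma max_theory_Bot : ~ u Bot.
Proof. by apply/asboolPn; rewrite -max_theoryE. Qed.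

Lemma max_theory_bigAnd (I : finType) (P : pred I) (F : I -> form) :
  u (\big[And/Top]_(i | P i) F i) <-> forall i, P i -> u (F i).
Proof.
split => [/asboolP|uF].
  rewrite -max_theoryE bool_val_bigAnd => /forallP/= uF i Pi.
  by apply/asboolP; have := uF i; rewrite Pi max_theoryE.
apply/asboolP; rewrite -max_theoryE bool_val_bigAnd; apply/forallP => i.
by apply/implyP => Pi; rewrite max_theoryE; apply/asboolP; exact: uF.
Qed.

End MaxTheory.

(** * The cluster of a maximal theory *)

Lemma bounded_set_range (T : choiceType) (C : set T) (n : nat) : C !=set0 ->
  (forall u : 'I_n.+1 -> T, injective u -> ~ (forall i, C (u i))) ->
  exists h : 'I_n -> T, range h = C.
Proof.
move=> [w Cw] Cn.
pose Q k := `[< exists s : seq T, [/\ size s = k, uniq s & forall x, x \in s -> C x] >].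
have Q0 : exists k, Q k by exists 0; apply/asboolP; exists [::].
have Qn k : Q k -> k <= n.
  move=> /asboolP[s [<- us Cs]]; rewrite leqNgt; apply/negP => ns.
  apply: (Cn (fun i => nth w s i)) => [i j /eqP|i]; last first.
    by apply/Cs/mem_nth; exact: leq_trans ns.
  rewrite nth_uniq// => [/eqP/val_inj//||]; exact: leq_trans ns.
have [k /asboolP[s [sk us Cs]] kmax] := ex_maxnP Q0 Qn.
have sE x : C x -> x \in s.
  move=> Cx; apply: contraPT isT => xs; have /kmax : Q k.+1; last by rewrite ltnn.
  apply/asboolP; exists (x :: s); split => /=; [by rewrite sk|by rewrite xs|].
  by move=> y; rewrite inE => /predU1P[->|/Cs].
exists (fun i => nth w s i); apply/seteqP; split => [_ [i _ <-]|x Cx].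
  have [is'|/(nth_default w)->//] := ltnP i (size s).
  exact/Cs/mem_nth.
have xs := sE _ Cx; have xn : index x s < n.
  by rewrite (leq_trans _ (Qn k _))// -?sk ?index_mem//; apply/asboolP; exists s.
by exists (Ordinal xn) => //=; rewrite nth_index.
Qed.

Section Cluster.
Context (n : nat) (G : set form).
Local Notation D := (derivable (S5n n) G).

Lemma derivable_theory : theory D.
Proof.
split; last exact: der_mp.
by move=> f tf; apply/der_thm/S5n_axiom/Ax_taut.
Qed.

Lemma derivable_DiaOr f g : D (Imp (Dia (Or f g)) (Or (Dia f) (Dia g))).
Proof.
apply: der_thm.
exact: (S5n_subst (fun k => if k is 0 then f else g) (S5n_axiom n Ax_DiaOr)).
Qed.

Lemma derivable_T f : D (Imp f (Dia f)).
Proof. by apply: der_thm; exact: (S5n_subst (fun=> f) (S5n_axiom n Ax_T)). Qed.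

Lemma derivable_4 f : D (Imp (Dia (Dia f)) (Dia f)).
Proof. by apply: der_thm; exact: (S5n_subst (fun=> f) (S5n_axiom n Ax_4)). Qed.

Lemma derivable_5 f : D (Imp (Dia f) (Box (Dia f))).
Proof. by apply: der_thm; exact: (S5n_subst (fun=> f) (S5n_axiom n Ax_5)). Qed.

Lemma derivable_NDiaBot : D (Neg (Dia Bot)).
Proof. by apply: der_thm; apply: S5n_axiom; exact: Ax_N. Qed.

Lemma derivable_mono_taut f g : tautology (Imp f g) -> D (Imp (Dia f) (Dia g)).
Proof. by move=> tfg; apply: der_mono; exact: derivable_theory.1. Qed.

Lemma derivable_Box f : D f -> D (Box f).
Proof.
move=> Df; have thD := derivable_theory.
have DB : D (Imp (Dia (Neg f)) (Dia Bot)).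
  by apply: der_mono; apply: theory1 Df => //; taut.
by apply: theory2 derivable_NDiaBot DB => //; taut.
Qed.

Section AtTheory.
Context (w : set form) (mw : max_theory w) (Dw : D `<=` w).

Let wN f : w (Neg f) <-> ~ w f. Proof. exact: mw.2. Qed.

Lemma max_theory_mono f g : D (Imp f g) -> w (Dia f) -> w (Dia g).
Proof. by move=> /der_mono/Dw; exact: mw.1.2. Qed.

Lemma Box_theory : theory [set f | w (Box f)].
Proof.
split => [f tf /=|f g /wN wfg /wN wf].
  by apply/Dw/derivable_Box; exact: derivable_theory.1.
apply/wN => wg.
have : w (Dia (Or (Neg (Imp f g)) (Neg f))).
  by apply: max_theory_mono wg; apply: derivable_theory.1; taut.
move=> /(mw.1.2 _ _ (Dw (derivable_DiaOr _ _))).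
by move=> /(max_theory_Or mw)[].
Qed.

Definition cluster : set (set form) :=
  [set u | [/\ max_theory u, D `<=` u & forall f, u (Dia f) <-> w (Dia f)]].

Lemma cluster_refl : cluster w. Proof. by split. Qed.

Lemma cluster_Dia f : w (Dia f) <-> exists2 u, cluster u & u f.
Proof.
split => [wf|[u [[thu _] Du uw] uf]]; last first.
  by apply/uw; exact: thu.2 _ _ (Du _ (derivable_T _)) uf.
have nN : ~ w (Box (Neg f)).
  by move/wN; apply; apply: max_theory_mono wf; apply: derivable_theory.1; taut.
have [u [mu Bu nu]] := Lindenbaum Box_theory nN.
exists u; last by apply: contrapT => /mu.2.
split => // [g Dg|g]; first by apply: Bu; exact/Dw/derivable_Box.
split => [ug|wg]; last first.
  by apply: Bu; exact: mw.1.2 _ _ (Dw (derivable_5 _)) wg.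
apply: contrapT => wg; suff /Bu/mu.2 : w (Box (Neg (Dia g))) by [].
apply/wN => wNN; apply: wg.
apply: mw.1.2 _ _ (Dw (derivable_4 _)) _.
by apply: max_theory_mono wNN; apply: derivable_theory.1; taut.
Qed.

(* Pairwise exclusive formulas separating [n + 1] points would refute the *)
(* alternativity axiom.                                                   *)
Lemma cluster_bound (u : 'I_n.+1 -> set form) :
  injective u -> ~ (forall i, cluster (u i)).
Proof.
move=> uinj Cu.
have muE i : max_theory (u i) by case: (Cu i).
have /choice[psi psiP] : forall p : 'I_n.+1 * 'I_n.+1, exists f, p.1 != p.2 ->
    u p.1 f /\ ~ u p.2 f.
  move=> [i j]; have [->|] := eqVneq i j; first by exists Bot.
  move=> ij; apply: contrapT => /forallNP nf.
  have sub f : u i f -> u j f.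
    move=> uif; apply: contrapT => ujf; apply: (nf f) => _; split => //.
  move/eqP : ij; apply; apply: uinj; apply/seteqP; split => // f ujf.
  apply: contrapT => /(muE i).2/sub/(muE j).2; exact.
pose phi i := \big[And/Top]_(j < n.+1 | j != i)
  And (psi (i, j)) (Neg (psi (j, i))).
have uphi i : u i (phi i).
  apply/max_theory_bigAnd => // j ji; apply/max_theory_And => //.
  split; first by have [] := psiP (i, j); rewrite //= eq_sym.
  by apply/(muE i).2; have [] := psiP (j, i) ji.
have Walt : bool_val (fun g => `[< w g >])
    (subst (fun k => phi (inord k)) (alt_axiom n)).
  by rewrite max_theoryE//; apply/asboolP/Dw/der_thm/S5n_subst/S5n_alt.
have [i|i [j [ij]]] := bool_val_alt Walt.
  apply/asboolP/cluster_Dia; exists (u i) => //.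
  by rewrite inord_val; exact: uphi.
move=> /asboolP/cluster_Dia[t [mt _ _]] /(max_theory_And mt).
rewrite !inord_val !max_theory_bigAnd// => -[/(_ j) + /(_ i)].
have nij : j != i by rewrite -val_eqE /= gtn_eqF.
rewrite [i == j]eq_sym nij => /(_ isT) + /(_ isT).
by move=> /(max_theory_And mt)[_ /mt.2 N] /(max_theory_And mt)[].
Qed.

End AtTheory.

(* The cluster refuting [f], with its points listed with repetition. *)
Lemma canonical_model f : ~ D f ->
  exists h : 'I_n -> set form,
    [/\ forall i, max_theory (h i), forall i, D `<=` h i,
        forall i g, h i (Dia g) <-> exists j, h j g &
        exists i, ~ h i f].
Proof.
move=> nDf; have [w [mw Dw wf]] := Lindenbaum derivable_theory nDf.
have Cw := cluster_refl mw Dw.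
have [h hC] : exists h : 'I_n -> set form, range h = cluster w.
  by apply: bounded_set_range; [exists w|exact: cluster_bound].
have Ch i : cluster w (h i) by rewrite -hC; exists i.
exists h; split => [i|i|i g|]; [by case: (Ch i)|by case: (Ch i)| |].
  have [_ _ ->] := Ch i; rewrite cluster_Dia//; split=> [[u]|[j hj]].
    by rewrite -hC => -[j _ <-] ?; exists j.
  by exists (h j).
have [i _ hi] : range h w by rewrite hC.
by exists i; rewrite hi.
Qed.

End Cluster.

(** * Validity in closure algebras *)

Section ClosureAlgebraTheory.
Context d (B : closureAlgType d).
Implicit Types (a b : B) (v : nat -> B).

Lemma clo_homo a b : (a <= b)%O -> (clo a <= clo b)%O.
Proof. by move=> /join_idPr <-; rewrite cloU leUl. Qed.

Lemma complU_eq1 a b : (~` a `|` b = \top)%O <-> (a <= b)%O.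
Proof.
split=> ab; first by apply/meet_idPr; rewrite -[RHS]meetx1 -ab meetUr meetxC join0x meetC.
by apply/eqP; rewrite -le1x -(joinCx a) leU2.
Qed.

Lemma eval_subst v s f : eval v (subst s f) = eval (fun p => eval v (s p)) f.
Proof. by elim: f => //= [f ->|f -> g ->|f -> g ->|f ->]. Qed.

Lemma S5n_sound n : (forall f, tautology f -> valid B f) ->
  (forall a, clo (~` clo a) = ~` clo a)%O ->
  valid B (alt_axiom n) -> sound (S5n n) B.
Proof.
move=> tautB cloC altB f; elim=> {f} => [f []| |s f _ IH v|f g _ fg _ f1 v|f g _ fg v].
- exact: tautB.
- by move=> v /=; rewrite complU_eq1 cloU.
- by move=> v /=; rewrite complU_eq1 le_clo.
- by move=> v /=; rewrite complU_eq1 clo_clo.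
- by move=> v /=; rewrite clo0 compl0.
- by move=> v /=; rewrite complU_eq1 cloC complK.
- exact: altB.
- by rewrite eval_subst IH.
- by have := fg v; rewrite /= f1 compl1 join0x.
- by apply/complU_eq1/clo_homo/complU_eq1/fg.
Qed.

Lemma val_eval (A : subalgebra B) (v : nat -> subalg_type A) f :
  \val (eval v f) = eval (fun p => \val (v p)) f.
Proof. by elim: f => //= [f <-|f <- g <-|f <- g <-|f <-]. Qed.

End ClosureAlgebraTheory.

(** * Closure in the Baire algebra *)

Section BaireTheory.
Context {X : topologicalType}.
Implicit Types (A U F : set X) (a b : Baire X).

Lemma BclassI A U : (Bclass A `&` Bclass U)%O = Bclass (A `&` U).
Proof. exact: BmeetE. Qed.

Lemma BclassU A U : (Bclass A `|` Bclass U)%O = Bclass (A `|` U).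
Proof. exact: BjoinE. Qed.

Lemma BclassC A : (~` Bclass A)%O = Bclass (~` A).
Proof. exact: BcomplE. Qed.

Lemma open_cst (Q : Prop) : open [set _ : X | Q].
Proof.
have [q|nq] := pselect Q.
  by rewrite (_ : mkset _ = setT); [exact: openT|apply/seteqP; split].
by rewrite (_ : mkset _ = set0); [exact: open0|apply/seteqP; split].
Qed.

Lemma eval_Bclass (v : nat -> Baire X) (s : form -> set X) f :
  (forall p, v p = Bclass (s (Var p))) ->
  (forall g, clo (eval v g) = Bclass (s (Dia g))) ->
  eval v f = Bclass [set x | bool_val (fun g => `[< s g x >]) f].
Proof.
move=> sV sD; elim: f => /= [p||f ->|f -> g ->|f -> g ->|f _].
- by rewrite sV; congr Bclass; apply/seteqP; split => x /asboolP.
- by congr Bclass; apply/seteqP; split.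
- by rewrite BclassC; congr Bclass; apply/seteqP; split => x /= /negP.
- by rewrite BclassI; congr Bclass; apply/seteqP; split => x /= /andP.
- by rewrite BclassU; congr Bclass; apply/seteqP; split => x /= /orP.
- by rewrite sD; congr Bclass; apply/seteqP; split => x /asboolP.
Qed.

Lemma tautology_valid_Baire f : tautology f -> valid (Baire X) f.
Proof.
move=> tf v; pose s g := repr (eval v g).
have sE g : eval v g = Bclass (s g) by rewrite /Bclass reprK.
rewrite (@eval_Bclass v s)// => [|p|g]; [|exact: (sE (Var p))|exact: (sE (Dia g))].
by rewrite (_ : [set x | _] = setT)//; apply/seteqP; split => // x _; exact: tf.
Qed.

Lemma Bclass_interior F : closed F -> Bclass F = Bclass F°.
Proof.
move=> cF; apply/eq_BclassP/meager_nowhere_dense.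
have -> : F `+` F° = F `&` ~` F°.
  apply/seteqP; split => x; rewrite setY_def /=; last by tauto.
  by move=> [//|[/interior_subset]].
rewrite /nowhere_dense -(closure_id _).1; last first.
  by apply: closedI => //; exact/open_closedC/open_interior.
apply/seteqP; split => // x Ix; have [_] := interior_subset Ix; apply.
by apply: interiorS Ix; exact: subIsetl.
Qed.

Lemma Bclo_closed F : closed F -> clo (Bclass F) = Bclass F.
Proof.
move=> cF; apply/le_anti; rewrite le_clo andbT.
by have [_ _] := Bclo_least (Bclass F); exact.
Qed.

Lemma Bclo_open U : open U -> clo (Bclass U) = Bclass U.
Proof.
move=> oU; have : clo (Bclass (~` (~` U)°)) = Bclass (~` (~` U)°).
  by apply/Bclo_closed/open_closedC/open_interior.
rewrite -BclassC -Bclass_interior; last exact: open_closedC.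
by rewrite BclassC setCK.
Qed.

Lemma Bclo_clopen a : exists2 U, open U & clo a = Bclass U.
Proof.
have [[F cF e] _ _] := Bclo_least a; exists F°; first exact: open_interior.
by rewrite -Bclass_interior.
Qed.

Lemma Bclo_complclo a : (clo (~` clo a) = ~` clo a)%O.
Proof.
have [U oU ->] := Bclo_clopen a.
by rewrite BclassC Bclo_closed//; exact: open_closedC.
Qed.

End BaireTheory.

(** * The subalgebra of a resolution *)

Section Resolution.
Context (X : topologicalType) (n : nat) (P : 'I_n -> set X).
Context (P0 : forall i, P i !=set0) (trivP : trivIset setT P).
Context (coverP : \bigcup_i P i = setT).
Context (denseP : forall i (U : set X),
  open U -> U !=set0 -> ~ meager (P i `&` U)).
Implicit Types (U V : 'I_n -> set X).

Definition glue U : set X := \bigcup_i (P i `&` U i).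

Lemma glueP i x U : P i x -> glue U x <-> U i x.
Proof.
move=> Pix; split=> [[j _ [Pjx Ujx]]|Uix]; last by exists i.
by rewrite (_ : i = j)//; apply: trivP => //; exists x.
Qed.

Lemma glue_ext U (S : set X) :
  (forall i x, P i x -> S x <-> U i x) -> S = glue U.
Proof.
move=> SU; apply/seteqP; split => x.
  have [i _ Pix] : (\bigcup_i P i) x by rewrite coverP.
  by move=> Sx; exists i => //; split=> //; apply/SU.
by move=> [i _ [Pix Uix]]; apply/(SU i).
Qed.

Lemma glue_cst (S : set X) : glue (fun=> S) = S.
Proof. by apply/esym/glue_ext. Qed.

Lemma glueI U V : glue U `&` glue V = glue (fun i => U i `&` V i).
Proof. by apply: glue_ext => i x Pix /=; rewrite !(glueP _ Pix). Qed.

Lemma glueU U V : glue U `|` glue V = glue (fun i => U i `|` V i).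
Proof. by apply: glue_ext => i x Pix /=; rewrite !(glueP _ Pix). Qed.

Lemma glueC U : ~` glue U = glue (fun i => ~` U i).
Proof. by apply: glue_ext => i x Pix /=; rewrite !(glueP _ Pix). Qed.

Lemma Bclass_glue U V : (forall i, Bclass (U i) = Bclass (V i)) ->
  Bclass (glue U) = Bclass (glue V).
Proof.
move=> UV; apply/eq_BclassP.
pose W k := if insub k is Some i then U i `+` V i else set0 : set X.
apply: (@meager_sub _ _ (\bigcup_k W k)); last first.
  apply: meager_bigcup => k; rewrite /W; case: insubP => [i _ _|_]; last exact: meager0.
  exact/eq_BclassP.
move=> x; have [i _ Pix] : (\bigcup_i P i) x by rewrite coverP.
rewrite setY_def /= => gx; exists i => //.
by rewrite /W valK setY_def /=; move: gx; rewrite !(glueP _ Pix).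
Qed.

(* Density of every [P i] makes the closure of [P i `&` U i] as large as that *)
(* of [U i], and open sets are clopen modulo meager sets.                     *)
Lemma clo_glue U : (forall i, open (U i)) ->
  clo (Bclass (glue U)) = Bclass (\bigcup_i U i).
Proof.
move=> oU; have oUU : open (\bigcup_i U i) by apply: bigcup_open.
apply/le_anti/andP; split.
  rewrite -(Bclo_open oUU); apply: clo_homo; apply/Bclass_le.
  by apply: meager_sub meager0 => x [[i _ [_ Uix]] []]; exists i.
have [[F cF e] + _] := Bclo_least (Bclass (glue U)).
rewrite [clo _]e e => /Bclass_le mF; apply/Bclass_le.
apply: meager_sub meager0 => x [[i _ Uix] nFx].
apply: (@denseP i (U i `&` ~` F)).
- by apply: openI => //; exact: closed_openC.
- by exists x.
- by apply: meager_sub mF => y [Piy [Uiy nFy]]; split => //; exists i.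
Qed.

Definition glued : {pred Baire X} := fun a =>
  `[< exists2 U, forall i, open (U i) & a = Bclass (glue U) >].

Lemma gluedP a :
  reflect (exists2 U, forall i, open (U i) & a = Bclass (glue U)) (a \in glued).
Proof. exact: asboolP. Qed.

Lemma glued_open (W : set X) : open W -> Bclass W \in glued.
Proof. by move=> oW; apply/gluedP; exists (fun=> W) => //; rewrite glue_cst. Qed.

Lemma glued_clopen a : clopen_elt a -> a \in glued.
Proof. by move=> [-> _]; have [U oU ->] := Bclo_clopen a; exact: glued_open. Qed.

Lemma gluedI : {in glued &, forall a b, (a `&` b)%O \in glued}.
Proof.
move=> _ _ /gluedP[U oU ->] /gluedP[V oV ->]; apply/gluedP.
exists (fun i => U i `&` V i) => [i|]; first exact: openI.
by rewrite BclassI glueI.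
Qed.

Lemma gluedU : {in glued &, forall a b, (a `|` b)%O \in glued}.
Proof.
move=> _ _ /gluedP[U oU ->] /gluedP[V oV ->]; apply/gluedP.
exists (fun i => U i `|` V i) => [i|]; first exact: openU.
by rewrite BclassU glueU.
Qed.

Lemma gluedC : {in glued, forall a, (~` a)%O \in glued}.
Proof.
move=> _ /gluedP[U oU ->]; apply/gluedP.
exists (fun i => (~` U i)°) => [i|]; first exact: open_interior.
rewrite BclassC glueC; apply: Bclass_glue => i.
exact/Bclass_interior/open_closedC.
Qed.

Lemma glued_clo : {in glued, forall a, clo a \in glued}.
Proof. by move=> a _; have [U oU ->] := Bclo_clopen a; exact: glued_open. Qed.

Definition glued_subalgebra : subalgebra (Baire X) :=
  Subalgebra (glued_open open0) (glued_open openT) gluedI gluedU gluedC glued_clo.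

Local Notation A := glued_subalgebra.

Lemma glued_alt : valid (subalg_type A) (alt_axiom n).
Proof.
move=> v; apply: val_inj; rewrite val_eval.
have /choice[U UP] : forall p, exists U,
    (forall i, open (U i)) /\ \val (v p) = Bclass (glue U).
  by move=> p; have /gluedP[U oU vU] := valP (v p); exists U.
set w := fun p => _.
pose s g := match g with
  | Var p => glue (U p)
  | Dia (Var p) => \bigcup_i U p i
  | Dia (And (Var p) (Var q)) => \bigcup_i (U p i `&` U q i)
  | _ => repr (eval w g)
  end.
have reprE a : a = Bclass (repr a) :> Baire X by rewrite /Bclass reprK.
have sDia g : clo (eval w g) = Bclass (s (Dia g)).
  case: g => [p||f|[p||f|f g|f g|f] [q||f'|f' g'|f' g'|f']|f g|f]; do ?exact: reprE.
  - by rewrite /= /w (UP p).2 clo_glue//; exact: (UP p).1.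
  - rewrite /= /w (UP p).2 (UP q).2 BclassI glueI clo_glue// => i.
    by apply: openI; [exact: (UP p).1|exact: (UP q).1].
rewrite (eval_Bclass _ (fun p => (UP p).2) sDia) (_ : [set x | _] = setT)//.
apply/seteqP; split => // x _ /=.
apply: bool_valT_alt => /= Ux.
have /choice[i iP] : forall k : 'I_n.+1, exists i, U k i x.
  by move=> k; have /asboolP[i _ Uix] := Ux k; exists i.
have [k [l [kl ikl]]] : exists k l : 'I_n.+1, k < l /\ i k = i l.
  have /injectivePn[k [l kl ikl]] : ~~ injectiveb i.
    by apply/negP => /injectiveP/leq_card; rewrite !card_ord ltnn.
  have [lt|lt|/val_inj e] := ltngtP k l; [by exists k, l|by exists l, k|].
  by rewrite e eqxx in kl.
exists k, l; split => //; apply/asboolP; exists (i k) => //.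
by split; [|rewrite ikl].
Qed.

Lemma glued_sound : sound (S5n n) (subalg_type A).
Proof.
apply: S5n_sound => [f tf v|a|]; last exact: glued_alt.
- by apply: val_inj; rewrite val_eval; exact: tautology_valid_Baire.
- by apply: val_inj; exact: Bclo_complclo.
Qed.

(* The power set algebra of ['I_n] embeds in the subalgebra as the unions of *)
(* the pieces [P i].                                                         *)
Lemma glued_union (Q : 'I_n -> Prop) :
  Bclass (glue (fun i => [set _ | Q i])) \in glued.
Proof. by apply/gluedP; eexists => // i; exact: open_cst. Qed.

Lemma glued_complete : strongly_complete (S5n n) (subalg_type A).
Proof.
move=> G f Gf; apply: contrapT => /canonical_model[h [mh Dh hDia [i0 nf]]].
pose v p := @SubalgElt _ _ A _ (glued_union (fun i => h i (Var p))).
have vE g :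
    eval (fun p => \val (v p)) g = Bclass (glue (fun i => [set _ | h i g])).
  elim: g => [p||g IH|g IHg k IHk|g IHg k IHk|g IH] /=.
  - by [].
  - rewrite -[LHS](congr1 Bclass (glue_cst set0)); congr (Bclass (glue _)).
    by apply/funext => i; apply/esym/seteqP; split => // x /(max_theory_Bot (mh i)).
  - rewrite IH BclassC glueC; congr (Bclass (glue _)).
    by apply/funext => i; apply/seteqP; split => x /= /(mh i).2.
  - rewrite IHg IHk BclassI glueI; congr (Bclass (glue _)).
    by apply/funext => i; apply/seteqP; split => x /= /(max_theory_And (mh i)).
  - rewrite IHg IHk BclassU glueU; congr (Bclass (glue _)).
    by apply/funext => i; apply/seteqP; split => x /= /(max_theory_Or (mh i)).
  - rewrite IH clo_glue => [|i]; last exact: open_cst.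
    congr Bclass; apply: glue_ext => i x _ /=; rewrite hDia.
    by split => [[j _]|[j]]; exists j.
have /(congr1 val) : eval v f = \top%O.
  apply: Gf => g Gg; apply: val_inj; rewrite val_eval vE.
  rewrite -[RHS](congr1 Bclass (glue_cst setT)); congr (Bclass (glue _)).
  by apply/funext => i; apply/seteqP; split => // x _; apply/Dh/der_hyp.
rewrite val_eval vE => /esym/eq_BclassP mf.
apply: (@denseP i0 setT) => //; first exact: openT.
  by have [x _] := P0 i0; exists x.
apply: meager_sub mf => x [Pix _]; rewrite setY_def; left; split => //.
by rewrite (glueP _ Pix).
Qed.

End Resolution.

Theorem theorem5p15 (X : topologicalType) (n : nat) :
  Baire_space X -> 1 <= n -> Baire_resolvable X n ->
  exists A : subalgebra (Baire X),
    [/\ forall a : Baire X, clopen_elt a -> a \in A,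
        sound (S5n n) (subalg_type A) &
        strongly_complete (S5n n) (subalg_type A)].
Proof.
move=> _ _ [P [P0 trivP coverP denseP]].
exists (glued_subalgebra trivP coverP); split.
- exact: glued_clopen.
- exact: glued_sound.
- exact: glued_complete.
Qed.
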